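(* Let $w\in S_n$ and let $C$ be a commutation class of reduced words for $w$ such that the heap poset $P_C$ has a horizontal folding symmetry $\varphi$ with associated order ideal $I$, and let $A=I\cap\varphi(I)$. Then the uniform vote tally $\rho=\mathbb 1_{\operatorname{Pre}(C)}$ has majority relation $\triangleleft_\rho$ equal to the intersection $<_u\cap<_v$ (as subsets of $[n]\times[n]$), where $u,v\in\operatorname{Pre}(C)$ are the permutations with $\operatorname{Inv}(u)=I\setminus A$ and $\operatorname{Inv}(v)=I$.
   Context: For $w=(w_1,\dots,w_n)\in S_n$, $<_w$ denotes the linear order $w_1<_w\cdots<_w w_n$ on $[n]$, and $\operatorname{Inv}(w)=\{(a,b):1\le a<b\le n,\ b<_w a\}$, pairs written $ab$. Let $s_i$ be the adjacent transposition of $i,i+1$; $ws_i$ is obtained from $w$ by swapping the entries in positions $i,i+1$. A reduced word for $w$ is $(i_1,\dots,i_\ell)$ with $w=s_{i_1}\cdots s_{i_\ell}$, $\ell=|\operatorname{Inv}(w)|$. The commutation class $C(\mathbf i)$ is the set of words obtained from $\mathbf i$ by repeatedly swapping adjacent entries differing by at least $2$. $\operatorname{Pre}(C)$ is the set of all $s_{i'_1}\cdots s_{i'_m}$ ($0\le m\le\ell$) with $(i'_1,\dots,i'_m)$ a prefix of a word in $C$; $w'\mapsto\operatorname{Inv}(w')$ is a bijection from $\operatorname{Pre}(C)$ to the order ideals of $P_C$. The heap poset $P_C$ on $\operatorname{Inv}(w)$: fix $\mathbf i\in C$, let $x_j$ be the unique element of $\operatorname{Inv}(s_{i_1}\cdots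 s_{i_j})\setminus\operatorname{Inv}(s_{i_1}\cdots s_{i_{j-1}})$; $P_C$ is the transitive closure of the relations $x_j<x_k$ for $j<k$ with $|i_j-i_k|\le 1$. A horizontal folding symmetry of a finite poset $P$ is a bijection $\varphi:P\to P$ with $x<_Py$ iff $\varphi(x)>_P\varphi(y)$, $\varphi^2=\mathrm{id}$, for which there is an order ideal $I$ with (i) $x\le_P\varphi(x)$ for all $x\in I$, (ii) $I\cup\varphi(I)=P$, (iii) $I\cap\varphi(I)$ is an antichain. The uniform vote tally $\mathbb 1_{\operatorname{Pre}(C)}$ is $1$ on $\operatorname{Pre}(C)$ and $0$ elsewhere on $S_n$. For a vote tally $\rho:S_n\to\mathbb N$, the majority relation is $a\triangleleft_\rho b$ iff $\sum_{w':\,a<_{w'}b}\rho(w')>\sum_{w':\,b<_{w'}a}\rho(w')$. *)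

(* Defs.v *)
From mathcomp Require Import all_boot all_order all_fingroup all_algebra.

Set Implicit Arguments.
Unset Strict Implicit.
Unset Printing Implicit Defensive.

(* Everything is 0-indexed: [n] is 'I_n, and the letter i of a word, which
   stands for the transposition exchanging i and i+1, ranges over 'I_n.-1.
   A permutation w : 'S_n has one-line notation w 0, w 1, ..., w (n-1). *)

Lemma pos_hi_subproof (n : nat) (i : 'I_n.-1) : i.+1 < n.
Proof. by case: n i => [[]|n [i]]. Qed.

Definition pos_lo (n : nat) (i : 'I_n.-1) : 'I_n := widen_ord (leq_pred n) i.
Definition pos_hi (n : nat) (i : 'I_n.-1) : 'I_n := Ordinal (pos_hi_subproof i).

Definition adj_transp (n : nat) (i : 'I_n.-1) : 'S_n :=
  tperm (pos_lo i) (pos_hi i).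

Definition before (n : nat) (w : 'S_n) : rel 'I_n :=
  fun a b => (w^-1%g a < w^-1%g b)%N.

Definition Inv (n : nat) (w : 'S_n) : {set 'I_n * 'I_n} :=
  [set p : 'I_n * 'I_n | (p.1 < p.2)%N && before w p.2 p.1].

(* In perm.v, (s * t) x = t (s x), so (adj_transp i * w) j = w (adj_transp i j):
   this is w with the entries in positions i and i+1 exchanged, that is, the
   product w s_i when permutations are composed from right to left. *)
Definition mul_adj (n : nat) (w : 'S_n) (i : 'I_n.-1) : 'S_n :=
  (adj_transp i * w)%g.

Definition word_perm (n : nat) (s : seq 'I_n.-1) : 'S_n :=
  foldl (@mul_adj n) 1%g s.

Definition reduced_word (n : nat) (w : 'S_n) (l : nat) (t : l.-tuple 'I_n.-1) :
    bool :=
  (word_perm t == w) && (l == #|Inv w|).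

(* adj_transp is used here on the l positions of the word. *)
Definition comm_step (n l : nat) : rel (l.-tuple 'I_n.-1) :=
  fun s t => [exists k : 'I_l.-1,
    (2 <= `|tnth s (pos_lo k) - tnth s (pos_hi k)|)%N
    && (t == [tuple tnth s (adj_transp k j) | j < l])].

Definition comm_class (n l : nat) (t : l.-tuple 'I_n.-1) :
    {set l.-tuple 'I_n.-1} :=
  [set t' | connect (@comm_step n l) t t'].

Definition comm_class_of (n : nat) (w : 'S_n) (l : nat)
    (C : {set l.-tuple 'I_n.-1}) : Prop :=
  exists2 t, reduced_word w t & C = comm_class t.

Definition Pre (n l : nat) (C : {set l.-tuple 'I_n.-1}) : {set 'S_n} :=
  [set word_perm (take m t) | t : l.-tuple 'I_n.-1 in C, m : 'I_l.+1 in setT].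

(* For a reduced word t this set is the singleton {x_j}. *)
Definition new_inv (n l : nat) (t : l.-tuple 'I_n.-1) (j : 'I_l) :
    {set 'I_n * 'I_n} :=
  Inv (word_perm (take j.+1 t)) :\: Inv (word_perm (take j t)).

Definition heap_elt (n : nat) (w : 'S_n) : finType :=
  {x : 'I_n * 'I_n | x \in Inv w}.

Definition heap_gen (n : nat) (w : 'S_n) (l : nat) (t : l.-tuple 'I_n.-1) :
    rel (heap_elt w) :=
  fun x y => [exists j : 'I_l, exists k : 'I_l,
    [&& (j < k)%N, (`|tnth t j - tnth t k| <= 1)%N,
        val x \in new_inv t j & val y \in new_inv t k]].

(* The transitive (not reflexive) closure of heap_gen. *)
Definition heap_lt (n : nat) (w : 'S_n) (l : nat) (t : l.-tuple 'I_n.-1) :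
    rel (heap_elt w) :=
  fun x y => [exists z, heap_gen t x z && connect (heap_gen (w := w) t) z y].

(* A finite poset is given by a finType with its strict order. *)
Section Folding.
Variables (P : finType) (lt : rel P).

Definition order_ideal (I : {set P}) : Prop :=
  forall x y, y \in I -> lt x y -> x \in I.

Definition antichain (A : {set P}) : Prop :=
  forall x y, x \in A -> y \in A -> ~~ lt x y.

Definition folding_ideal (phi : P -> P) (I : {set P}) : Prop :=
  [/\ order_ideal I,
      forall x, x \in I -> (x == phi x) || lt x (phi x),
      I :|: phi @: I = [set: P]
    & antichain (I :&: phi @: I)].

Definition horizontal_folding_symmetry (phi : P -> P) : Prop :=
  [/\ bijective phi,
      forall x y, lt x y = lt (phi y) (phi x),
      involutive phi
    & exists I, folding_ideal phi I].

End Folding.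

Definition vote_tally (n : nat) := 'S_n -> nat.

Definition uniform_tally (n : nat) (S : {set 'S_n}) : vote_tally n :=
  fun w => (w \in S : nat).

Definition majority (n : nat) (rho : vote_tally n) : rel 'I_n :=
  fun a b => (\sum_(w : 'S_n | before w b a) rho w
              < \sum_(w : 'S_n | before w a b) rho w)%N.

Definition rel_set (T : finType) (r : rel T) : {set T * T} :=
  [set p : T * T | r p.1 p.2].

(* Main.v *)
(** Let [x_j] be the inversion created by the [j]-th letter of a reduced word.
    Swapping two commuting letters permutes the [x_j] accordingly, so the heap
    order depends only on the class, and the prefixes of the words of the class
    are exactly the order ideals of the heap.  The folding symmetry gives the
    involution [J |-> P \ phi(J)] on ideals, whence as many ideals avoid [x] as
    contain [phi x].  Ideals containing [phi x] contain [x] when [x < phi x], so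
    a strict majority contains [x] if [x < phi x], avoids [x] if [phi x < x],
    and there is a tie if [phi x = x].  These cases are [x \in I :\: A],
    [x \notin I] and [x \in A] respectively. *)
Require Import Defs.
From mathcomp Require Import all_boot all_order all_fingroup all_algebra.
From mathcomp Require Import zify.

Set Implicit Arguments.
Unset Strict Implicit.
Unset Printing Implicit Defensive.

(** * Adjacent transpositions and inversion sets *)

Lemma adj_transpE (n : nat) (i : 'I_n.-1) (j : 'I_n) :
  adj_transp i j =
    (if j == i :> nat then i.+1 else if j == i.+1 :> nat then nat_of_ord i else j)
    :> nat.
Proof.
by rewrite /adj_transp permE /= -!val_eqE /=; case: eqP => //; case: eqP.
Qed.

Lemma adj_transpK (n : nat) (i : 'I_n.-1) : involutive (adj_transp i).
Proof. exact: tpermK. Qed.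

Lemma adj_transp_lo (n : nat) (i : 'I_n.-1) : adj_transp i (pos_lo i) = pos_hi i.
Proof. exact: tpermL. Qed.

Lemma adj_transp_hi (n : nat) (i : 'I_n.-1) : adj_transp i (pos_hi i) = pos_lo i.
Proof. exact: tpermR. Qed.

Lemma adj_transp_lt (n : nat) (i : 'I_n.-1) (x y : 'I_n) :
  ~~ ((x == pos_lo i) && (y == pos_hi i)) -> x < y ->
  adj_transp i x < adj_transp i y.
Proof. rewrite !adj_transpE -!val_eqE /=; do ![case: eqP => /= ?]; lia. Qed.

Lemma mul_adjE (n : nat) (w : 'S_n) (i : 'I_n.-1) (j : 'I_n) :
  mul_adj w i j = w (adj_transp i j).
Proof. by rewrite permM. Qed.

Lemma mul_adjVE (n : nat) (w : 'S_n) (i : 'I_n.-1) (a : 'I_n) :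
  ((mul_adj w i)^-1)%g a = adj_transp i ((w^-1)%g a).
Proof. by rewrite invMg permM tpermV. Qed.

Lemma mul_adjK (n : nat) (w : 'S_n) (i : 'I_n.-1) : mul_adj (mul_adj w i) i = w.
Proof. by apply/permP => j; rewrite !mul_adjE adj_transpK. Qed.

Lemma mul_adjC (n : nat) (w : 'S_n) (i j : 'I_n.-1) :
  1 < `|i - j| -> mul_adj (mul_adj w i) j = mul_adj (mul_adj w j) i.
Proof.
move=> hij; apply/permP => x; rewrite !mul_adjE; congr (w _).
apply/val_inj; rewrite /= !(adj_transpE _ (adj_transp _ _)).
have := adj_transpE i x; have := adj_transpE j x.
move: (nat_of_ord (adj_transp i x)) (nat_of_ord (adj_transp j x)) => y z.
do ![case: eqP => /= ?]; lia.
Qed.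

Lemma word_perm_rcons (n : nat) (s : seq 'I_n.-1) (i : 'I_n.-1) :
  word_perm (rcons s i) = mul_adj (word_perm s) i.
Proof. by rewrite /word_perm -cats1 foldl_cat. Qed.

Lemma in_Inv (n : nat) (w : 'S_n) (a b : 'I_n) :
  ((a, b) \in Inv w) = (a < b) && before w b a.
Proof. by rewrite inE. Qed.

Lemma beforeE (n : nat) (w : 'S_n) (a b : 'I_n) :
  before w a b = if a < b then (a, b) \notin Inv w else (b, a) \in Inv w.
Proof.
rewrite !in_Inv /before; case: (ltngtP a b) => //= [ab|/val_inj->]; last first.
  by rewrite ltnn.
rewrite -leqNgt ltn_neqAle; case: eqP => //= /val_inj /perm_inj eab.
by rewrite eab ltnn in ab.
Qed.

(** The position of [a] in [w] is the number of entries that precede it, and by [beforeE] the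
    inversion set decides which entries those are. *)
Lemma Inv_inj (n : nat) : injective (@Inv n).
Proof.
have cardE (w : 'S_n) a : (w^-1)%g a = #|[set c | before w c a]| :> nat.
  have -> : [set c | before w c a] = w @: [set j : 'I_n | j < (w^-1)%g a].
    apply/setP => c; rewrite inE -{2}(permKV w c) mem_imset ?inE //.
    exact: perm_inj.
  rewrite card_imset; last exact: perm_inj.
  rewrite -sum1_card; under eq_bigl do rewrite inE.
  by rewrite (big_ord_narrow (ltnW (ltn_ord _))) sum1_card card_ord.
move=> u v euv; apply: invg_inj; apply/permP => a; apply/val_inj; rewrite /= !cardE.
by apply: eq_card => c; rewrite !inE !beforeE euv.
Qed.

(** Seen from positions rather than entries, the only pair whose relative order changes is the one
    at [pos_lo i], [pos_hi i]; the hypothesis makes this pair a new inversion. *)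
Lemma Inv_mul_adj (n : nat) (w : 'S_n) (i : 'I_n.-1) :
  w (pos_lo i) < w (pos_hi i) ->
  Inv (mul_adj w i) = (w (pos_lo i), w (pos_hi i)) |: Inv w.
Proof.
move=> hlt; apply/setP => -[c d]; rewrite in_setU1 !in_Inv /before !mul_adjVE.
rewrite -(permKV w c) -(permKV w d) !permK; set x := _ c; set y := _ d.
rewrite xpair_eqE !(inj_eq perm_inj) -xpair_eqE.
have [[-> ->]|nxy] := eqVneq (x, y) (pos_lo i, pos_hi i).
  by rewrite hlt adj_transp_lo adj_transp_hi /= leqnn.
have [[-> ->]|nyx] := eqVneq (y, x) (pos_lo i, pos_hi i).
  by rewrite ltnNge (ltnW hlt).
case: (w x < w y) => //=; move: nxy nyx.
rewrite !adj_transpE !xpair_eqE -!val_eqE /=; do ![case: eqP => /= ?]; lia.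
Qed.

(** At a descent, [w] arises from [mul_adj w i] by an ascent, so [Inv_mul_adj] applies in the
    reverse direction and [Inv w] is the larger set. *)
Lemma card_Inv_mul_adj (n : nat) (w : 'S_n) (i : 'I_n.-1) :
  #|Inv (mul_adj w i)| <= #|Inv w| + (w (pos_lo i) < w (pos_hi i)).
Proof.
case: ltnP => [lt_w|ge_w]; first by rewrite Inv_mul_adj // cardsU1; lia.
rewrite addn0 -{2}(mul_adjK w i) (Inv_mul_adj (w := mul_adj w i)) ?subset_leq_card ?subsetUr //.
have -> : mul_adj w i (pos_lo i) = w (pos_hi i) by rewrite mul_adjE adj_transp_lo.
have -> : mul_adj w i (pos_hi i) = w (pos_lo i) by rewrite mul_adjE adj_transp_hi.
rewrite ltn_neqAle ge_w andbT val_eqE (inj_eq perm_inj) -val_eqE /=; lia.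
Qed.

(* The inversion x_j of the paper when t is reduced: see new_invE. *)
Definition word_elt (n l : nat) (t : l.-tuple 'I_n.-1) (j : 'I_l) : 'I_n * 'I_n :=
  (word_perm (take j t) (pos_lo (tnth t j)),
   word_perm (take j t) (pos_hi (tnth t j))).

Lemma take_tnth (T : Type) (l : nat) (t : l.-tuple T) (j : 'I_l) :
  take j.+1 t = rcons (take j t) (tnth t j).
Proof. by rewrite (tnth_nth (tnth t j)) (take_nth (tnth t j)) ?size_tuple. Qed.

Lemma eq_imset_mem (aT rT : finType) (f : aT -> rT) (A B : {set aT}) :
  A =i B -> f @: A = f @: B.
Proof. by move/setP->. Qed.

(** * Inversions created along a reduced word *)

Section Reduced.
Variables (n : nat) (w : 'S_n) (l : nat) (t : l.-tuple 'I_n.-1).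
Hypothesis red_t : reduced_word w t.

(** Each of the [k] dropped letters can add at most one inversion. Together with [card_Inv_take_le]
    this leaves no slack in a reduced word. *)
Lemma card_Inv_take_ge (k : nat) :
  k <= l -> #|Inv w| <= #|Inv (word_perm (take (l - k) t))| + k.
Proof.
elim: k => [_|k IHk lt_kl].
  by rewrite subn0 take_oversize ?size_tuple //; case/andP: red_t => /eqP-> _; rewrite addn0.
apply: leq_trans (IHk (ltnW lt_kl)) _.
have lt_j : l - k.+1 < l by lia.
have -> : l - k = (Ordinal lt_j).+1 by rewrite /=; lia.
rewrite take_tnth word_perm_rcons /=.
set v := word_perm _; have := card_Inv_mul_adj v (tnth t (Ordinal lt_j)).
rewrite addnS -addSn leq_add2r => /leq_trans-> //.
by rewrite -(addn1 #|Inv v|) leq_add2l leq_b1.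
Qed.

Lemma card_Inv_take_le (m : nat) : m <= l -> #|Inv (word_perm (take m t))| <= m.
Proof.
elim: m => [_|m IHm lt_ml].
  rewrite take0 leqn0 cards_eq0; apply/eqP/setP => -[a b].
  by rewrite in_Inv in_set0 /before !invg1 !perm1; lia.
rewrite (take_tnth t (Ordinal lt_ml)) word_perm_rcons /=.
have := card_Inv_mul_adj (word_perm (take m t)) (tnth t (Ordinal lt_ml)).
by move/leq_trans; apply; rewrite -(addn1 m) leq_add ?leq_b1 ?IHm // ltnW.
Qed.

(** Were letter [j] a descent, the prefix of length [j.+1] would have at most [j] inversions, and
    the remaining [l - j.+1] letters could not bring the count up to [l]. *)
Lemma word_elt_lt (j : 'I_l) : (word_elt t j).1 < (word_elt t j).2.
Proof.
have le_jl : l - j.+1 <= l by lia.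
have := card_Inv_take_ge le_jl; have := card_Inv_take_le (ltnW (ltn_ord j)).
case/andP: red_t => _ /eqP <-; rewrite subKn // take_tnth word_perm_rcons.
have /= := card_Inv_mul_adj (word_perm (take j t)) (tnth t j).
case: ltnP => // _; rewrite addn0.
move=> le1 le2; have := leq_trans le1 le2; move: (ltn_ord j).
set c := #|_|; clearbody c; lia.
Qed.

Lemma Inv_takeS (j : 'I_l) :
  Inv (word_perm (take j.+1 t)) = word_elt t j |: Inv (word_perm (take j t)).
Proof. by rewrite take_tnth word_perm_rcons (Inv_mul_adj (word_elt_lt j)). Qed.

Lemma Inv_take (m : nat) : m <= l ->
  Inv (word_perm (take m t)) = [set word_elt t j | j : 'I_l & j < m].
Proof.
elim: m => [_|m IHm lt_ml].
  rewrite (_ : [set j : 'I_l | j < 0] = set0) ?imset0; last first.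
    by apply/setP => j; rewrite !inE.
  apply/eqP; rewrite -cards_eq0 -leqn0; exact: card_Inv_take_le.
rewrite (Inv_takeS (Ordinal lt_ml)) /= IHm 1?ltnW // -imsetU1; apply: eq_imset_mem => j.
by rewrite !inE -val_eqE /= [RHS]ltnS [RHS]leq_eqVlt.
Qed.

Lemma Inv_word : Inv w = word_elt t @: [set: 'I_l].
Proof.
have := Inv_take (leqnn l); rewrite take_oversize ?size_tuple //.
case/andP: red_t => /eqP -> _ ->; apply: eq_imset_mem => j.
by rewrite !inE ltn_ord.
Qed.

Lemma word_elt_notin (j : 'I_l) : word_elt t j \notin Inv (word_perm (take j t)).
Proof. by rewrite in_Inv negb_and /before !permK /= orbC; lia. Qed.

(** For [j < k], the element of [j] is already an inversion of the prefix of length [k], whereas the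
    element of [k] is not. *)
Lemma word_elt_inj : injective (word_elt t).
Proof.
have lt_neq (j k : 'I_l) : j < k -> word_elt t j != word_elt t k.
  move=> lt_jk; apply: contra (word_elt_notin k) => /eqP <-.
  rewrite Inv_take 1?ltnW //; apply: imset_f; by rewrite inE.
move=> j k ejk; case: (ltngtP j k) => [/lt_neq|/lt_neq|/val_inj //];
  by rewrite ejk eqxx.
Qed.

Lemma new_invE (j : 'I_l) : new_inv t j = [set word_elt t j].
Proof.
apply/setP => p; rewrite /new_inv Inv_takeS in_setD in_setU1 in_set1.
by case: eqP => [->|_] /=; rewrite ?andbT ?andNb //; apply: word_elt_notin.
Qed.

End Reduced.

(** * Invariance of the heap under commutation moves *)

Definition comm_swap (n l : nat) (t : l.-tuple 'I_n.-1) (k : 'I_l.-1) :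
  l.-tuple 'I_n.-1 := [tuple tnth t (adj_transp k j) | j < l].

Lemma tnth_comm_swap (n l : nat) (t : l.-tuple 'I_n.-1) (k : 'I_l.-1) (j : 'I_l) :
  tnth (comm_swap t k) j = tnth t (adj_transp k j).
Proof. by rewrite tnth_mktuple. Qed.

Lemma comm_swapK (n l : nat) (t : l.-tuple 'I_n.-1) (k : 'I_l.-1) :
  comm_swap (comm_swap t k) k = t.
Proof. by apply: eq_from_tnth => j; rewrite !tnth_comm_swap adj_transpK. Qed.

Lemma adj_transp_far (n : nat) (i j : 'I_n.-1) : 1 < `|i - j| ->
  adj_transp i (pos_lo j) = pos_lo j /\ adj_transp i (pos_hi j) = pos_hi j.
Proof.
move=> hij; split; apply/val_inj; rewrite /= adj_transpE /=;
  do ![case: eqP => /= ?]; lia.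
Qed.

Section Swap.
Variables (n l : nat) (t : l.-tuple 'I_n.-1) (k : 'I_l.-1).
Hypothesis far_k : 1 < `|tnth t (pos_lo k) - tnth t (pos_hi k)|.

(** Every prefix contains both exchanged letters or neither, except the one of length [k.+1], which
    separates them. *)
Lemma word_perm_take_swap (m : nat) : m <= l -> m != k.+1 ->
  word_perm (take m (comm_swap t k)) = word_perm (take m t).
Proof.
elim/ltn_ind: m => -[|m] IHm lt_ml ne_mk; first by rewrite !take0.
pose j := Ordinal lt_ml.
rewrite (take_tnth _ j) (take_tnth t j) !word_perm_rcons tnth_comm_swap.
(* Here [m] is the position of the last letter of the prefix. If [m = k.+1], that letter is the
   second of the exchanged pair and commutativity is needed; otherwise the letter has not moved. *)
have [emk|ne_mk'] := eqVneq m k.+1; last first.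
  rewrite IHm //= 1?ltnW //; congr (mul_adj _ (tnth _ _)).
  by apply/val_inj; rewrite /= adj_transpE /= -eqSS (negPf ne_mk) (negPf ne_mk').
have -> : j = pos_hi k by apply/val_inj.
rewrite [nat_of_ord (pos_hi k)]/= -[nat_of_ord k]/(nat_of_ord (pos_lo k)) !take_tnth.
rewrite !word_perm_rcons tnth_comm_swap adj_transp_lo adj_transp_hi.
have pre_k : word_perm (take k (comm_swap t k)) = word_perm (take k t).
  by apply: IHm; have := ltn_ord k; lia.
by rewrite pre_k; apply/esym/mul_adjC.
Qed.

(** The transposition of either exchanged letter fixes the two positions on which the other acts, so
    each letter still inverts the same pair of entries. *)
Lemma word_elt_swap (j : 'I_l) :
  word_elt (comm_swap t k) j = word_elt t (adj_transp k j).
Proof.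
have [lo_far hi_far] := adj_transp_far far_k.
have far_k' : 1 < `|tnth t (pos_hi k) - tnth t (pos_lo k)| by lia.
have [lo_far' hi_far'] := adj_transp_far far_k'.
have pre_k : word_perm (take k (comm_swap t k)) = word_perm (take k t).
  by apply: word_perm_take_swap; have := ltn_ord k; lia.
have take_hi (s : l.-tuple 'I_n.-1) :
    word_perm (take (pos_hi k) s) = mul_adj (word_perm (take k s)) (tnth s (pos_lo k)).
  by rewrite -word_perm_rcons -(take_tnth s (pos_lo k)).
rewrite /word_elt tnth_comm_swap.
have [->|ne_lo] := eqVneq j (pos_lo k).
  by rewrite adj_transp_lo take_hi pre_k !mul_adjE lo_far hi_far.
have [->|ne_hi] := eqVneq j (pos_hi k).
  rewrite adj_transp_hi take_hi tnth_comm_swap pre_k !mul_adjE adj_transp_lo.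
  by rewrite lo_far' hi_far'.
have -> : adj_transp k j = j by rewrite /adj_transp tpermD // eq_sym.
by rewrite word_perm_take_swap // ltnW.
Qed.

Lemma reduced_swap (w : 'S_n) : reduced_word w t -> reduced_word w (comm_swap t k).
Proof.
have ne_lk : l != k.+1 by have := ltn_ord k; lia.
have := word_perm_take_swap (leqnn l) ne_lk.
by rewrite !take_oversize ?size_tuple // /reduced_word => ->.
Qed.

End Swap.

Lemma comm_stepP (n l : nat) (t t' : l.-tuple 'I_n.-1) :
  reflect (exists2 k : 'I_l.-1, 1 < `|tnth t (pos_lo k) - tnth t (pos_hi k)|
             & t' = comm_swap t k) (comm_step t t').
Proof.
apply: (iffP existsP) => [[k /andP[far_k /eqP ->]]|[k far_k ->]]; exists k => //.
by rewrite far_k eqxx.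
Qed.

Lemma comm_step_sym (n l : nat) : symmetric (@comm_step n l).
Proof.
suff imp (t t' : l.-tuple 'I_n.-1) : comm_step t t' -> comm_step t' t.
  by move=> t t'; apply/idP/idP; apply: imp.
case/comm_stepP => k far_k ->; apply/comm_stepP; exists k; rewrite ?comm_swapK //.
by rewrite !tnth_comm_swap adj_transp_lo adj_transp_hi; lia.
Qed.

Lemma heap_genP (n : nat) (w : 'S_n) (l : nat) (t : l.-tuple 'I_n.-1)
    (x y : heap_elt w) : reduced_word w t ->
  reflect (exists j k : 'I_l, [/\ j < k, `|tnth t j - tnth t k| <= 1,
             val x = word_elt t j & val y = word_elt t k])
          (heap_gen t x y).
Proof.
move=> red_t; apply: (iffP existsP) => [[j /existsP[k]]|[j [k [lt_jk near ex ey]]]].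
  rewrite !(new_invE red_t) !inE => /and4P[lt_jk near /eqP ex /eqP ey].
  by exists j, k.
exists j; apply/existsP; exists k.
by rewrite lt_jk near !(new_invE red_t) !inE ex ey !eqxx.
Qed.

(** A swap relabels positions by [adj_transp k], which reverses only the pair at [k], [k.+1]; the
    letters there are far apart, so that pair generates no relation. *)
Lemma heap_gen_step (n : nat) (w : 'S_n) (l : nat) (t t' : l.-tuple 'I_n.-1) :
  reduced_word w t -> comm_step t t' -> heap_gen (w := w) t =2 heap_gen t'.
Proof.
have imp (s s' : l.-tuple 'I_n.-1) x y : reduced_word w s -> comm_step s s' ->
    heap_gen (w := w) s x y -> heap_gen s' x y.
  move=> red_s /comm_stepP[k far_k ->] /(heap_genP _ _ red_s)[i [j [ij near ex ey]]].
  apply/heap_genP; first exact: reduced_swap.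
  exists (adj_transp k i), (adj_transp k j).
  rewrite !tnth_comm_swap !word_elt_swap // !adj_transpK; split=> //.
  apply: adj_transp_lt => //; apply/negP => /andP[/eqP ei /eqP ej].
  by move: far_k near; rewrite ei ej; lia.
move=> red_t stp x y; apply/idP/idP; apply: imp => //; last by rewrite comm_step_sym.
by case/comm_stepP: stp => k far_k ->; apply: reduced_swap.
Qed.

Lemma comm_class_invariant (n : nat) (w : 'S_n) (l : nat) (t t' : l.-tuple 'I_n.-1) :
  reduced_word w t -> connect (@comm_step n l) t t' ->
  reduced_word w t' /\ heap_gen (w := w) t =2 heap_gen t'.
Proof.
move=> red_t /connectP[p + ->]; elim: p t red_t => [//|s p IHp] t red_t /=.
case/andP => step_ts path_p; have red_s : reduced_word w s.
  by case/comm_stepP: step_ts => k far_k ->; apply: reduced_swap.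
have [red_p gen_p] := IHp s red_s path_p; split=> // x y.
by rewrite (heap_gen_step red_t step_ts) gen_p.
Qed.

(** * The heap order and the ideals given by prefixes *)

Lemma mem_val_imset (n : nat) (w : 'S_n) (J : {set heap_elt w}) (x : heap_elt w) :
  (val x \in val @: J) = (x \in J).
Proof. exact: mem_imset val_inj. Qed.

(** For arbitrary [u] this forgets the inversions outside [Inv w]; for [u] in [Pre] it forgets
    nothing, by [Pre_ideal]. *)
Definition inv_ideal (n : nat) (w u : 'S_n) : {set heap_elt w} :=
  [set x | val x \in Inv u].

Lemma in_inv_ideal (n : nat) (w u : 'S_n) (x : heap_elt w) :
  (x \in inv_ideal w u) = (val x \in Inv u).
Proof. exact: in_set. Qed.

Section HeapOrder.
Variables (n : nat) (w : 'S_n) (l : nat) (t : l.-tuple 'I_n.-1).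
Hypothesis red_t : reduced_word w t.

Lemma heap_pos (x : heap_elt w) : exists j : 'I_l, val x = word_elt t j.
Proof.
have /imsetP[j _ ->] : val x \in word_elt t @: [set: 'I_l].
  by rewrite -(Inv_word red_t); apply: valP.
by exists j.
Qed.

Lemma heap_of_pos (j : 'I_l) : exists x : heap_elt w, val x = word_elt t j.
Proof.
have jP : word_elt t j \in Inv w by rewrite (Inv_word red_t) imset_f.
by exists (exist (fun p => p \in Inv w) _ jP).
Qed.

(** The order of the letters in [t] is a linear extension of the heap, which therefore has no
    cycles. *)
Lemma connect_heap_pos (x y : heap_elt w) (j k : 'I_l) :
  val x = word_elt t j -> val y = word_elt t k ->
  connect (heap_gen (w := w) t) x y -> j <= k.
Proof.
move=> ex ey /connectP[p path_p last_p].
elim: p x j ex path_p last_p => [|z p IHp] x j ex /=.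
  by move=> _ eyx; rewrite eyx ex in ey; rewrite (word_elt_inj red_t ey).
case/andP => /(heap_genP _ _ red_t)[j' [k' [lt_jk _ ex' ez]]] path_p last_p.
rewrite ex in ex'; rewrite (word_elt_inj red_t ex').
exact: leq_trans (ltnW lt_jk) (IHp z k' ez path_p last_p).
Qed.

Lemma heap_lt_irr : irreflexive (heap_lt (w := w) t).
Proof.
move=> x; apply/existsP => -[z /andP[/(heap_genP _ _ red_t)[j [k [lt_jk _ ex ez]]]]].
by move/(connect_heap_pos ez ex); rewrite leqNgt lt_jk.
Qed.

Lemma heap_lt_trans : transitive (heap_lt (w := w) t).
Proof.
move=> y x z /existsP[x' /andP[gx cx]] /existsP[y' /andP[gy cy]].
apply/existsP; exists x'; rewrite gx /=.
exact: connect_trans cx (connect_trans (connect1 gy) cy).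
Qed.

Lemma order_ideal_gen (J : {set heap_elt w}) :
  order_ideal (heap_gen t) J <-> order_ideal (heap_lt t) J.
Proof.
split=> idJ x y yJ; last first.
  by move=> gxy; apply: idJ yJ _; apply/existsP; exists y; rewrite gxy connect0.
case/existsP => z /andP[gxz /connectP[p path_p last_p]]; apply: (idJ x z) gxz.
elim: p z path_p last_p => [z _ /= <- //|z' p IHp z /= /andP[gz path_p] last_p].
exact: idJ (IHp z' path_p last_p) gz.
Qed.

Lemma order_ideal_prefix (m : nat) : m <= l ->
  order_ideal (heap_gen t) (inv_ideal w (word_perm (take m t))).
Proof.
move=> le_ml x y; rewrite !in_inv_ideal (Inv_take red_t) // => /imsetP[k' lt_km ey'].
case/(heap_genP _ _ red_t) => j [k [lt_jk _ -> ey]].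
rewrite ey in ey'; rewrite -(word_elt_inj red_t ey') inE in lt_km.
by apply: imset_f; rewrite inE (ltn_trans lt_jk).
Qed.

Lemma Inv_take_sub (m : nat) : m <= l -> Inv (word_perm (take m t)) \subset Inv w.
Proof. by move=> le_ml; rewrite (Inv_take red_t) // (Inv_word red_t) imsetS ?subsetT. Qed.

End HeapOrder.

(** * Every order ideal of the heap comes from a prefix *)

Lemma down_closed_prefix (l : nat) (K : {set 'I_l}) :
  (forall k : 'I_l.-1, pos_hi k \in K -> pos_lo k \in K) ->
  exists m : 'I_l.+1, K = [set j : 'I_l | j < m].
Proof.
move=> downK; have le_cK : #|K| < l.+1 by rewrite ltnS -[leqRHS](card_ord l) max_card.
have down (d : nat) (j k : 'I_l) : k = j + d :> nat -> k \in K -> j \in K.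
  elim: d k => [|d IHd] k ek kK.
    by rewrite (_ : j = k) //; apply/val_inj; rewrite /= ek addn0.
  have lt_i : j + d < l.-1 by have := ltn_ord k; lia.
  apply: (IHd (pos_lo (Ordinal lt_i))) => //; apply: downK.
  by rewrite (_ : pos_hi _ = k) //; apply/val_inj; rewrite /= ek addnS.
have card_lt (m : nat) : m <= l -> #|[set j : 'I_l | j < m]| = m.
  move=> le_ml; rewrite -sum1_card; under eq_bigl do rewrite inE.
  by rewrite (big_ord_narrow le_ml) sum1_card card_ord.
(* The length is [#|K|]. If [j] is in [K], so are all [i <= j], whence [j < #|K|]; if not, all of
   [K] lies below [j], whence [#|K| <= j]. *)
exists (Ordinal le_cK); apply/setP => j; rewrite inE /=.
apply/idP/idP => [jK|].
  rewrite -(card_lt j.+1) //; apply/subset_leq_card/subsetP => i.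
  by rewrite inE ltnS => le_ij; apply: (down (j - i)) jK; rewrite subnKC.
apply: contraLR => jK; rewrite -leqNgt -[leqRHS](card_lt j (ltnW (ltn_ord j))).
apply/subset_leq_card/subsetP => i iK; rewrite inE ltnNge.
by apply: contra jK => le_ji; apply: (down (i - j)) iK; rewrite subnKC.
Qed.

(* Among the words of the class, take one minimising the sum of the positions
   of the letters of J: an adjacent pair whose second letter only is in J would
   commute since J is an ideal, and swapping it would lower the sum. *)
Lemma prefix_of_ideal (n : nat) (w : 'S_n) (l : nat) (t : l.-tuple 'I_n.-1)
    (J : {set heap_elt w}) :
  reduced_word w t -> order_ideal (heap_gen t) J ->
  exists t' (m : 'I_l.+1), connect (@comm_step n l) t t' /\
    Inv (word_perm (take m t')) = val @: J.
Proof.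
move=> red_t idJ.
pose K (s : l.-tuple 'I_n.-1) := [set j : 'I_l | word_elt s j \in val @: J].
pose mu s := \sum_(j in K s) (j : nat).
case: (@arg_minnP _ t (connect (@comm_step n l) t) mu); first exact: connect0.
move=> s ts min_s; have [red_s gen_s] := comm_class_invariant red_t ts.
have downK k : pos_hi k \in K s -> pos_lo k \in K s.
  move=> hiK; apply/negPn/negP => loK.
  (* Letters differing by at most 1 would make the two elements related in the heap, and the ideal
     [J] would contain the earlier one. *)
  case: (ltnP 1 `|tnth s (pos_lo k) - tnth s (pos_hi k)|) => [far_k|near_k]; last first.
    have [x ex] := heap_of_pos red_s (pos_lo k).
    have [y ey] := heap_of_pos red_s (pos_hi k).
    move: loK; rewrite inE -ex mem_val_imset => /negP; apply.
    apply: (idJ x y); first by move: hiK; rewrite inE -ey mem_val_imset.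
    rewrite gen_s; apply/(heap_genP _ _ red_s).
    by exists (pos_lo k), (pos_hi k); split=> //=.
  have /min_s : connect (@comm_step n l) t (comm_swap s k).
    by apply: connect_trans ts (connect1 _); apply/comm_stepP; exists k.
  rewrite leqNgt => /negP; apply.
  (* Reindexing by the swap turns both sums into sums over [K s]. The term of [pos_hi k] drops by
     one and no other grows, since [pos_lo k] is not in [K s]. *)
  rewrite /mu (reindex_inj (inv_inj (adj_transpK k))) /=.
  rewrite (eq_bigl (mem (K s))); last first.
    by move=> j; rewrite !inE word_elt_swap // adj_transpK.
  rewrite (bigD1 _ hiK) [ltnRHS](bigD1 _ hiK) /= adj_transp_hi /= addSn ltnS leq_add2l.
  apply: leq_sum => j /andP[jK ne_j]; rewrite adj_transpE.
  case: eqP => [ej|_]; last by case: eqP => // ->.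
  by case/negP: loK; have <- : j = pos_lo k by apply/val_inj.
have [m eK] := down_closed_prefix downK.
have le_ml : m <= l by rewrite -ltnS ltn_ord.
exists s, m; split; first exact: ts.
rewrite (Inv_take red_s le_ml) -eK.
apply/setP => p; apply/imsetP/idP => [[j + ->]|pJ]; first by rewrite inE.
have [x xJ ep] := imsetP pJ; have [j ex] := heap_pos red_s x.
by exists j; rewrite ?inE -ex -?ep.
Qed.

(** * Counting ideals under an order-reversing involution *)

Section Ideals.
Variables (P : finType) (lt : rel P).

Definition ideals : {set {set P}} :=
  [set J : {set P} | [forall x, forall y, (y \in J) && lt x y ==> (x \in J)]].

Lemma idealsP (J : {set P}) : reflect (order_ideal lt J) (J \in ideals).
Proof.
rewrite inE; apply: (iffP forallP) => [idJ x y yJ xy|idJ x].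
  by have /forallP/(_ y) := idJ x; rewrite yJ xy.
by apply/forallP => y; apply/implyP => /andP[yJ xy]; apply: idJ xy.
Qed.

Variable phi : P -> P.
Hypothesis lt_irr : irreflexive lt.
Hypothesis lt_trans : transitive lt.
Hypothesis phi_anti : forall x y, lt x y = lt (phi y) (phi x).
Hypothesis phiK : involutive phi.

(** Since [phi] is an involution, this is the complement of [phi @: J]. *)
Definition ideal_flip (J : {set P}) : {set P} := [set x | phi x \notin J].

Lemma ideal_flipK : involutive ideal_flip.
Proof. by move=> J; apply/setP => x; rewrite !inE phiK negbK. Qed.

Lemma ideal_flip_ideals (J : {set P}) : (ideal_flip J \in ideals) = (J \in ideals).
Proof.
have flip_id K : K \in ideals -> ideal_flip K \in ideals.
  move/idealsP => idK; apply/idealsP => x y; rewrite !inE phi_anti => yK xy.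
  by apply: contra yK => xK; apply: idK xK xy.
by apply/idP/idP => [/flip_id|/flip_id //]; rewrite ideal_flipK.
Qed.

Lemma card_ideals_flip (x : P) :
  #|[set J in ideals | x \notin J]| = #|[set J in ideals | phi x \in J]|.
Proof.
rewrite -(card_imset _ (inv_inj ideal_flipK)); apply: eq_card => J.
rewrite -{1}(ideal_flipK J) mem_imset; last exact: inv_inj ideal_flipK.
by rewrite in_set [RHS]in_set ideal_flip_ideals [x \in _]in_set negbK.
Qed.

Lemma card_ideals_lt (x : P) : lt x (phi x) ->
  #|[set J in ideals | x \notin J]| < #|[set J in ideals | x \in J]|.
Proof.
move=> ltx; rewrite card_ideals_flip; apply/proper_card/properP; split.
  apply/subsetP => J; rewrite in_set => /andP[idJ xJ]; rewrite in_set idJ.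
  by move/idealsP: idJ => idJ; apply: idJ ltx.
(* The principal ideal of [x] contains [x] but not [phi x], so the inclusion is strict. *)
exists [set y | (y == x) || lt y x]; last first.
  rewrite in_set negb_and [phi x \in _]in_set; apply/orP; right; rewrite negb_or.
  rewrite (contraTN _ ltx) => [|/eqP ->]; last by rewrite lt_irr.
  by apply/negP => /(lt_trans ltx); rewrite lt_irr.
rewrite in_set [x \in _]in_set eqxx andbT; apply/idealsP => y z.
by rewrite !in_set => /predU1P[-> ->|zx yz]; rewrite ?orbT // (lt_trans yz zx) orbT.
Qed.

(** This is [card_ideals_lt] at [phi x], with both counts carried back by the flip. *)
Lemma card_ideals_gt (x : P) : lt (phi x) x ->
  #|[set J in ideals | x \in J]| < #|[set J in ideals | x \notin J]|.
Proof.
move=> gtx; have := card_ideals_lt (x := phi x); rewrite phiK => /(_ gtx).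
by rewrite card_ideals_flip phiK -card_ideals_flip.
Qed.

Lemma card_ideals_fix (x : P) : phi x = x ->
  #|[set J in ideals | x \in J]| = #|[set J in ideals | x \notin J]|.
Proof. by move=> fx; rewrite card_ideals_flip fx. Qed.

Section FoldingIdeal.
Variable I : {set P}.
Hypothesis hI : folding_ideal lt phi I.

Lemma mem_phi_imset (x : P) : (x \in phi @: I) = (phi x \in I).
Proof. by rewrite -{1}(phiK x) mem_imset //; apply: inv_inj. Qed.

(** Both [x] and [phi x] lie in the antichain [I :&: phi @: I], which excludes [lt x (phi x)]. *)
Lemma folding_fix (x : P) : x \in I -> phi x \in I -> phi x = x.
Proof.
case: hI => _ le_phi _ antiA xI pxI.
have xA : x \in I :&: phi @: I by rewrite inE xI mem_phi_imset.
have pxA : phi x \in I :&: phi @: I by rewrite inE pxI mem_phi_imset phiK.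
by case/predU1P: (le_phi x xI) => // ltx; case/negP: (antiA _ _ xA pxA).
Qed.

Lemma folding_lt (x : P) : x \in I -> phi x \notin I -> lt x (phi x).
Proof.
case: hI => _ le_phi _ _ xI pxI; case/predU1P: (le_phi x xI) => // ex.
by rewrite -ex xI in pxI.
Qed.

(** The covering condition puts [phi x] in [I], and [folding_lt] applies to it. *)
Lemma folding_gt (x : P) : x \notin I -> lt (phi x) x.
Proof.
move=> xI; rewrite -{2}(phiK x) folding_lt ?phiK //.
case: hI => _ _ /setP/(_ x); rewrite in_setU in_setT (negPf xI) /=.
by rewrite mem_phi_imset => ->.
Qed.

(** This yields the existence of [u]. If [x] lies below [y] and [phi x] is in [I], then [phi x = x],
    so [phi y] lies below [x] and is in [I] too, putting [y] in the antichain. *)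
Lemma folding_lower_ideal : order_ideal lt (I :\: (I :&: phi @: I)).
Proof.
move=> x y; rewrite !in_setD !in_setI !mem_phi_imset => /andP[+ yI] xy.
have xI : x \in I by case: hI => idI _ _ _; apply: idI xy.
rewrite xI yI /= andbT => pyI; apply: contra pyI => pxI.
have := folding_fix xI pxI; move: (xy); rewrite phi_anti => + ex; rewrite ex.
by case: hI => idI _ _ _; apply: idI.
Qed.

End FoldingIdeal.
End Ideals.

(** * The bijection between prefix permutations and ideals *)

Section PreIdeals.
Variables (n : nat) (w : 'S_n) (l : nat) (t : l.-tuple 'I_n.-1).
Hypothesis red_t : reduced_word w t.

Lemma Pre_ideal (u : 'S_n) : u \in Pre (comm_class t) ->
  inv_ideal w u \in ideals (heap_lt t) /\ Inv u = val @: inv_ideal w u.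
Proof.
case/imset2P => s m; rewrite inE => ts _ ->.
have [red_s gen_s] := comm_class_invariant red_t ts.
have le_ml : m <= l by rewrite -ltnS.
split.
  apply/idealsP/(order_ideal_gen t) => x y yJ; rewrite gen_s.
  exact: order_ideal_prefix yJ.
apply/setP => p; apply/idP/imsetP => [pu|[x + ->]]; last by rewrite in_inv_ideal.
have pw : p \in Inv w by apply: subsetP pu; apply: Inv_take_sub.
by exists (exist (fun p => p \in Inv w) p pw); rewrite ?in_inv_ideal.
Qed.

Lemma ideal_Pre (J : {set heap_elt w}) : order_ideal (heap_lt t) J ->
  exists2 u, u \in Pre (comm_class t) & Inv u = val @: J.
Proof.
move/(order_ideal_gen t)/(prefix_of_ideal red_t) => [s [m [ts eJ]]].
by exists (word_perm (take m s)) => //; apply: imset2_f; rewrite ?inE.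
Qed.

(** The map [inv_ideal w] is injective on [Pre] by [Inv_inj] and reaches every ideal by [ideal_Pre],
    so counts of votes become counts of ideals. *)
Lemma card_Pre_ideals (Q : pred {set heap_elt w}) :
  #|[set u in Pre (comm_class t) | Q (inv_ideal w u)]|
    = #|[set J in ideals (heap_lt t) | Q J]|.
Proof.
rewrite -(card_in_imset (f := inv_ideal w)); last first.
  move=> u v; rewrite in_set => /andP[/Pre_ideal[_ eu] _].
  rewrite in_set => /andP[/Pre_ideal[_ ev] _] euv.
  by apply: Inv_inj; rewrite eu ev euv.
apply: eq_card => J; apply/imsetP/idP => [[u]|].
  by rewrite in_set => /andP[/Pre_ideal[idu _] Qu] ->; rewrite in_set idu.
rewrite in_set => /andP[/idealsP/ideal_Pre[u uC eu] QJ].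
have eJ : J = inv_ideal w u by apply/setP => x; rewrite in_inv_ideal eu mem_val_imset.
by exists u => //; rewrite in_set uC -eJ.
Qed.

End PreIdeals.

(** * The majority relation *)

Lemma sum_uniform_tally (n : nat) (S : {set 'S_n}) (Q : pred 'S_n) :
  \sum_(u | Q u) uniform_tally S u = #|[set u in S | Q u]|.
Proof.
rewrite -sum1_card big_mkcond [RHS]big_mkcond; apply: eq_bigr => u _.
by rewrite !inE /uniform_tally; case: (Q u); case: (u \in S).
Qed.

Lemma comm_class_eq (n l : nat) (t s : l.-tuple 'I_n.-1) :
  s \in comm_class t -> comm_class s = comm_class t.
Proof.
rewrite inE => ts; apply/setP => r; rewrite !inE.
by rewrite (same_connect (sym_connect_sym (@comm_step_sym n l)) ts).
Qed.

Theorem theorem3p5 (n : nat) (w : 'S_n) (l : nat)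
    (C : {set l.-tuple 'I_n.-1}) (hC : comm_class_of w C)
    (t : l.-tuple 'I_n.-1) (ht : t \in C)
    (phi : heap_elt w -> heap_elt w)
    (hphi : horizontal_folding_symmetry (heap_lt (w := w) t) phi)
    (I : {set heap_elt w})
    (hI : folding_ideal (heap_lt (w := w) t) phi I) :
  let A := I :&: phi @: I in
  exists u v : 'S_n,
    [/\ unique (fun u' => u' \in Pre C /\ Inv u' = val @: (I :\: A)) u,
        unique (fun v' => v' \in Pre C /\ Inv v' = val @: I) v
      & rel_set (majority (uniform_tally (Pre C)))
        = rel_set (before u) :&: rel_set (before v)].
Proof.
move=> A; case: hC => t0 red_t0 eC; rewrite eC in ht.
have red_t : reduced_word w t.
  by move: (ht); rewrite inE => /(comm_class_invariant red_t0)[].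
rewrite {C}eC -(comm_class_eq ht).
have [_ phi_anti phiK _] := hphi; have [idI _ _ _] := hI.
have irr := heap_lt_irr red_t; have trans := @heap_lt_trans _ w _ t.
have [u uC eu] := ideal_Pre red_t (folding_lower_ideal phi_anti phiK hI).
have [v vC ev] := ideal_Pre red_t idI.
exists u, v; split; [split=> // u' [_ eu'] | split=> // v' [_ ev'] |].
- by apply: Inv_inj; rewrite eu eu'.
- by apply: Inv_inj; rewrite ev ev'.
have subw u' : u' \in Pre (comm_class t) -> {subset Inv u' <= Inv w}.
  by case/(Pre_ideal red_t) => _ -> p /imsetP[x _ ->]; apply: valP.
have memu (x : heap_elt w) : (val x \in Inv u) = (x \in I) && (phi x \notin I).
  rewrite eu mem_val_imset in_setD in_setI mem_phi_imset //.
  by case: (x \in I); rewrite ?andbF ?andbT.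
have memv (x : heap_elt w) : (val x \in Inv v) = (x \in I).
  by rewrite ev mem_val_imset.
(* Both orientations of a pair are settled at once, so [a < b] may be assumed. *)
have key (a b : 'I_n) : a < b ->
    (majority (uniform_tally (Pre (comm_class t))) a b
       = before u a b && before v a b) /\
    (majority (uniform_tally (Pre (comm_class t))) b a
       = before u b a && before v b a).
  move=> lt_ab; have nlt_ba : (b < a) = false by rewrite ltnNge ltnW.
  rewrite /majority !sum_uniform_tally !beforeE lt_ab nlt_ba.
  have -> : [set u' in Pre (comm_class t) | before u' b a]
          = [set u' in Pre (comm_class t) | (a, b) \in Inv u'].
    by apply/setP => u'; rewrite in_set [RHS]in_set beforeE nlt_ba.
  have -> : [set u' in Pre (comm_class t) | before u' a b]
          = [set u' in Pre (comm_class t) | (a, b) \notin Inv u'].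
    by apply/setP => u'; rewrite in_set [RHS]in_set beforeE lt_ab.
  (* Off [Inv w] the vote for [a] before [b] is unanimous; the majority is strict because [u] itself
     is a voter. *)
  case: (boolP ((a, b) \in Inv w)) => [abw|nabw]; last first.
    have nab u' : u' \in Pre (comm_class t) -> (a, b) \notin Inv u'.
      by move=> /subw sub_u'; apply: contra nabw => /sub_u'.
    rewrite (negPf (nab u uC)) (negPf (nab v vC)).
    have -> : [set u' in Pre (comm_class t) | (a, b) \in Inv u'] = set0.
      apply/setP => u'; rewrite in_set in_set0.
      by case: (boolP (u' \in _)) => // /nab/negPf.
    rewrite cards0 ltn0; split=> //; rewrite card_gt0; apply/set0Pn; exists u.
    by rewrite in_set uC nab.
  pose x : heap_elt w := exist (fun p => p \in Inv w) _ abw.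
  have -> : #|[set u' in Pre (comm_class t) | (a, b) \in Inv u']|
          = #|[set J in ideals (heap_lt (w := w) t) | x \in J]|.
    rewrite -(card_Pre_ideals red_t (fun J => x \in J)); apply: eq_card => u'.
    by rewrite in_set [RHS]in_set in_inv_ideal.
  have -> : #|[set u' in Pre (comm_class t) | (a, b) \notin Inv u']|
          = #|[set J in ideals (heap_lt (w := w) t) | x \notin J]|.
    rewrite -(card_Pre_ideals red_t (fun J => x \notin J)); apply: eq_card => u'.
    by rewrite in_set [RHS]in_set in_inv_ideal.
  rewrite -[(a, b)]/(val x) memu memv.
  (* Outside [I] neither [u] nor [v] inverts the pair. When [x] and [phi x] are both in [I], only
     [v] does, so the tie matches the disagreement of the two orders. In the remaining case both
     invert it. *)
  case: (boolP (x \in I)) => xI; last first.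
    have lt_x := card_ideals_gt irr trans phi_anti phiK (folding_gt phiK hI xI).
    by rewrite lt_x ltnNge ltnW.
  case: (boolP (phi x \in I)) => pxI.
    by rewrite (card_ideals_fix phi_anti phiK (folding_fix phiK hI xI pxI)) ltnn.
  have lt_x := card_ideals_lt irr trans phi_anti phiK (folding_lt hI xI pxI).
  by rewrite lt_x ltnNge ltnW.
apply/setP => -[a b]; rewrite in_setI !in_set /=.
case: (ltngtP a b) => [/key[]|/key[]|/val_inj ->] //.
by rewrite /majority /before !ltnn.
Qed.
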